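(* Every $0$-hyperbolic proper metric space $X$ admits an $8$-bilipschitz embedding $f\colon X\to Y$ into a complete $\mathbb{R}$-tree $Y$ such that $\operatorname{sing}Y\subset f(X)$.
   Context: A metric space $X$ is $0$-\emph{hyperbolic} if $d(w,x)+d(y,z)\leq\max\{d(w,y)+d(x,z),\,d(w,z)+d(x,y)\}$ for all $x,y,z,w\in X$. It is \emph{proper} if every closed ball of finite radius is compact. A map $f\colon X\to Y$ between metric spaces is $C$-\emph{bilipschitz}, for a constant $C\geq 0$, if there exists $s>0$ such that $s\,d(x,y)\leq d(f(x),f(y))\leq Cs\,d(x,y)$ for all $x,y\in X$. An $\mathbb{R}$-\emph{tree} is a geodesic and $0$-hyperbolic metric space, where geodesic means that every two points $x,x'$ are the endpoints of the image of an isometric embedding of a compact interval. (Equivalently: a uniquely geodesic metric space $Y$ such that $[y_1,y_2]\cap[y_2,y_3]=\{y_2\}$ implies $[y_1,y_2]\cup[y_2,y_3]=[y_1,y_3]$, for all $y_1,y_2,y_3\in Y$.) A point $y\in Y$ is \emph{regular} if there exists an isometric embedding $U(y,\varepsilon)\to\mathbb{R}$ for some $\varepsilon>0$, where $U(y,\varepsilon)$ is the open ball of radius $\varepsilon$ centered at $y$. Every point which is not regular is \emph{singular}, and $\operatorname{sing}Y$ denotes the set of singular points of $Y$. *)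

(* Defs.v *)
From HB Require Import structures.
From mathcomp Require Import all_boot all_order all_algebra.
From mathcomp Require Import all_classical all_reals all_analysis.

Set Implicit Arguments.
Unset Strict Implicit.
Unset Printing Implicit Defensive.

Import Order.TTheory GRing.Theory Num.Theory.
Import numFieldNormedType.Exports.

Local Open Scope classical_set_scope.
Local Open Scope ring_scope.

Definition hyperbolic0 (R : realType) (X : metricType R) : Prop :=
  forall x y z w : X,
    mdist w x + mdist y z <=
      Num.max (mdist w y + mdist x z) (mdist w z + mdist x y).

(* The library's [closed_ball] is the closure of the open ball, which can be
   strictly smaller than the closed metric ball used here. *)
Definition proper_space (R : realType) (X : metricType R) : Prop :=
  forall (x : X) (r : R), compact [set y : X | mdist x y <= r].

(* The condition of the library's mixin [Uniform_isComplete], which cannot be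
   used directly because it requires a pointed type. *)
Definition complete_space (R : realType) (X : metricType R) : Prop :=
  forall F : set_system X, ProperFilter F -> cauchy F ->
    exists l : X, F --> l.

Definition bilipschitz (R : realType) (X Y : metricType R) (C : R)
    (f : X -> Y) : Prop :=
  exists2 s : R, 0 < s &
    forall x y : X,
      s * mdist x y <= mdist (f x) (f y) <= C * s * mdist x y.

(* Only the values of [f] on [A] matter: this says that the restriction of [f]
   to [A] is an isometric embedding. *)
Definition isometric_on (R : realType) (X Y : metricType R) (A : set X)
    (f : X -> Y) : Prop :=
  forall x y : X, A x -> A y -> mdist (f x) (f y) = mdist x y.

Definition geodesic (R : realType) (Y : metricType R) : Prop :=
  forall x x' : Y, exists (a b : R) (g : R^o -> Y),
    [/\ a <= b, isometric_on (`[a, b] : set R^o) g, g a = x & g b = x'].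

Definition R_tree (R : realType) (Y : metricType R) : Prop :=
  geodesic Y /\ hyperbolic0 Y.

Definition regular_point (R : realType) (Y : metricType R) (y : Y) : Prop :=
  exists2 e : R, 0 < e &
    exists h : Y -> R^o, isometric_on (ball y e) h.

Definition sing (R : realType) (Y : metricType R) : set Y :=
  [set y : Y | ~ regular_point y].
Arguments sing {R} Y.

(* Main.v *)
Require Import Defs.
From HB Require Import structures.
From mathcomp Require Import all_boot all_order all_algebra.
From mathcomp Require Import all_classical all_reals all_analysis.
From mathcomp Require Import lra.

(** For a finite set with root r, let p be a nearest point to r. The points whose
    Gromov product with p at r is at least 3/4 d(r,p) form a cluster C. Replace C
    (rooted at p) and its complement (rooted at r) by trees recursively and join
    them by an edge rp of length d(r,p). The new tree metric d' satisfies
    d'(r,x) <= 2 d(r,x), while d(r,x) + d(r,y) <= 4 d(x,y) for x in C and y outside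
    C, whence d <= d' <= 8 d. By construction the branching points are in the set.

    An ultrafilter on the finite subsets of X gives a limit metric on X. It is
    still 0-hyperbolic and within a factor 8 of d, and by properness of X the
    medians converge, so that X contains its own branching points. Attaching to
    each point of X the segment from the root gives the tree Y; a ball of Y that
    misses X contains no branching point, so it lies on one such segment. *)

Set Implicit Arguments.
Unset Strict Implicit.
Unset Printing Implicit Defensive.

Import Order.TTheory GRing.Theory Num.Theory.
Import numFieldNormedType.Exports.

Local Open Scope classical_set_scope.
Local Open Scope ring_scope.

(** * Gromov products and the pseudometrics they define *)

(* [P p q] plays the role of the Gromov product of [p] and [q] at a base point;
   [P p p] is then the height of [p] above it. *)
Definition gdist (R : realType) (T : Type) (P : T -> T -> R) (p q : T) : R :=
  P p p + P q q - 2 * P p q.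

(** The minimum condition is 0-hyperbolicity written for products at a base point; for [q] equal to
    [p] it bounds [P p z] by [P p p]. Negative values are allowed, for points below the base
    point. *)
Record gromov_on (R : realType) (T : Type) (A : set T) (P : T -> T -> R) :
    Prop := GromovOn {
  gromov_on_sym : forall p q, A p -> A q -> P p q = P q p;
  gromov_on_min : forall p q z, A p -> A q -> A z ->
    Num.min (P p z) (P z q) <= P p q }.

Section gdist_theory.
Context {R : realType} {T : Type} (A : set T) (P : T -> T -> R).
Hypothesis gP : gromov_on A P.

Lemma gromov_or p q z : A p -> A q -> A z ->
  P p z <= P p q \/ P q z <= P p q.
Proof.
move=> Ap Aq Az; have := gromov_on_min gP Ap Aq Az.
by rewrite ge_min (gromov_on_sym gP Az Aq) => /orP.
Qed.

Lemma gromov_le_diag p q : A p -> A q -> P p q <= P p p.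
Proof. by move=> Ap Aq; case: (gromov_or Ap Ap Aq). Qed.

Lemma gdistC p q : A p -> A q -> gdist P p q = gdist P q p.
Proof. by move=> Ap Aq; rewrite /gdist (gromov_on_sym gP Aq Ap); lra. Qed.

Lemma gdist_triangle z p q : A p -> A q -> A z ->
  gdist P p q <= gdist P p z + gdist P z q.
Proof.
move=> Ap Aq Az; rewrite /gdist (gromov_on_sym gP Az Aq).
have := gromov_le_diag Az Ap; have := gromov_le_diag Az Aq.
rewrite (gromov_on_sym gP Az Aq) (gromov_on_sym gP Az Ap).
by case: (gromov_or Ap Aq Az); lra.
Qed.

Lemma gromov_height_lip p q : A p -> A q -> `|P p p - P q q| <= gdist P p q.
Proof.
move=> Ap Aq; have := gromov_le_diag Ap Aq; have := gromov_le_diag Aq Ap.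
by rewrite (gromov_on_sym gP Aq Ap) ler_norml /gdist => ? ?; apply/andP; lra.
Qed.

Lemma gromov_lip p q z : A p -> A q -> A z -> P q z - gdist P p q <= P p z.
Proof.
move=> Ap Aq Az; rewrite /gdist.
have := gromov_le_diag Ap Aq; have := gromov_le_diag Aq Ap.
have := gromov_le_diag Aq Az; rewrite (gromov_on_sym gP Aq Ap).
by case: (gromov_or Ap Az Aq); rewrite ?(gromov_on_sym gP Az Aq); lra.
Qed.

(** The diagonal terms agree in all three sums, so [P w x + P y z] has to be at least the smaller of
    the other two sums of products. *)
Lemma gdist_4point x y z w : A x -> A y -> A z -> A w ->
  gdist P w x + gdist P y z <=
  Num.max (gdist P w y + gdist P x z) (gdist P w z + gdist P x y).
Proof.
move=> Ax Ay Az Aw; rewrite /gdist le_max; apply/orP.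
have := gromov_or Aw Ax Ay; have := gromov_or Aw Ax Az.
have := gromov_or Ay Az Ax; have := gromov_or Ay Az Aw.
rewrite !(gromov_on_sym gP Ay Ax, gromov_on_sym gP Az Ax,
  gromov_on_sym gP Ay Aw, gromov_on_sym gP Az Aw).
case: (leP (P w x) (P y z)) => ? [] ? [] ? [] ? [] ?;
  by solve [left; lra | right; lra].
Qed.

End gdist_theory.

(** * Tree approximations of finite sets *)

(** The inequalities for the median [m] force equalities, so [m] is where the paths from the root to
    [x] and [y] part. The factor 2 on heights is what gives the factor 8 on distances across a
    cut. *)
Record tree_approx (R : realType) (X : metricType R) (r : X) (A : set X)
    (G : X -> X -> R) : Prop := TreeApprox {
  tree_approx_gromov : gromov_on A G;
  tree_approx_root : G r r = 0;
  tree_approx_ge0 : forall x y, A x -> A y -> 0 <= G x y;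
  tree_approx_median : forall x y, A x -> A y ->
    exists m, [/\ A m, G m m <= G x y, G x y <= G m x & G x y <= G m y];
  tree_approx_dist : forall x y, A x -> A y ->
    mdist x y <= gdist G x y <= 8 * mdist x y;
  tree_approx_height : forall x, A x -> G x x <= 2 * mdist r x }.

Lemma tree_approx_rootE (R : realType) (X : metricType R) (r : X) (A : set X)
    (G : X -> X -> R) : tree_approx r A G -> A r ->
  forall x, A x -> gdist G r x = G x x.
Proof.
move=> [gG G0 Gge0 _ _ _] Ar x Ax.
have := gromov_le_diag gG Ar Ax; have := Gge0 _ _ Ar Ax.
by rewrite /gdist G0; lra.
Qed.

Lemma seq_minimizer (R : realDomainType) (T : eqType) (h : T -> R) (x0 : T)
    (s : seq T) : x0 \in s ->
  exists2 p, p \in s & forall x, x \in s -> h p <= h x.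
Proof.
elim: s x0 => [//|a s IH] x0 _.
case: s IH => [|b s] IH.
  by exists a; rewrite ?mem_head// => x; rewrite inE => /eqP ->.
have [p ps pmin] := IH b (mem_head _ _).
have [ap|pa] := leP (h a) (h p).
  exists a; rewrite ?mem_head// => x; rewrite inE => /orP[/eqP -> //|/pmin].
  exact: le_trans.
exists p; first by rewrite inE ps orbT.
by move=> x; rewrite inE => /orP[/eqP ->|/pmin //]; exact: ltW.
Qed.

Section finite_tree_approx.
Context {R : realType} {X : metricType R}.
Hypothesis hypX : hyperbolic0 X.

(* [C] consists of the points whose Gromov product with [p] based at [r] is at
   least [3/4 d(r, p)]. Cutting at the fraction [c] of [d(r, p)] makes heights
   grow by a factor at most [1 / (2c - 1)], and distances across the cut lose a
   factor [1 / (1 - c)]; [c = 3/4] minimizes the product, which is then 8. *)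
Lemma glue_tree_approx (A : set X) (r p : X)
    (C := [set x | 3 * mdist r p <= 2 * (mdist r x + mdist r p - mdist p x)])
    (G G' : X -> X -> R) :
  A r -> A p -> r != p ->
  (forall x, A x -> x != r -> mdist r p <= mdist r x) ->
  tree_approx r (A `\` C) G -> tree_approx p (A `&` C) G' ->
  exists H, tree_approx r A H.
Proof.
move=> Ar Ap rp pmin tG tG'.
have b_gt0 : 0 < mdist r p by rewrite mdist_gt0.
have Cp : C p by rewrite /C/= mdistxx; lra.
have Cr : ~ C r by rewrite /C/= mdistxx (metric_sym p r); lra.
have Cne x : C x -> x != r by move=> Cx; apply/eqP => xr; rewrite xr in Cx.
(* The tree of [C] hangs at the end of an edge of length [mdist r p] from [r]; points on different
   sides part at [r], at height 0. *)
pose H x y := if x \in C then if y \in C then mdist r p + G' x y else 0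
              else if y \in C then 0 else G x y.
have dec x : (C x * ((x \in C) = true)) + ((~ C x) * ((x \in C) = false)).
  have [Cx|Cx] := pselect (C x); [left|right]; split=> //.
    exact: mem_set.
  exact: memNset.
have rC : (r \in C) = false by rewrite memNset.
have pC : (p \in C) = true by rewrite mem_set.
have sep x y : A x -> A y -> C x -> ~ C y ->
    mdist r x + mdist r y <= 4 * mdist x y.
  move=> Ax Ay Cx Cy; have rx := pmin x Ax (Cne x Cx).
  have [->|yr] := eqVneq y r.
    by rewrite mdistxx (metric_sym x r); have := mdist_ge0 r x; lra.
  have ry := pmin y Ay yr.
  (* The cut rules out the second alternative. The first gives d(r,x) + d(r,y) < 3/2 d(r,p) +
     d(x,y), where both terms on the left are at least d(r,p). *)
  have := hypX y r x p; rewrite le_max (metric_sym y x) (metric_sym y r).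
  move: Cx Cy; rewrite /C/= => Cx /negP; rewrite -ltNge => Cy.
  by rewrite (metric_sym p r); case/orP; lra.
have hgt x : A x -> H x x <= 2 * mdist r x.
  move=> Ax; have [[Cx xC]|[Cx xC]] := dec x; rewrite /H xC.
    (* Membership in [C] reads 2 d(p,x) + d(r,p) <= 2 d(r,x), which absorbs the new edge. *)
    have := tree_approx_height tG' (conj Ax Cx).
    by move: Cx; rewrite /C/=; lra.
  exact: (tree_approx_height tG (conj Ax Cx)).
have dist10 x y : A x -> A y -> C x -> ~ C y ->
    mdist x y <= gdist H x y <= 8 * mdist x y.
  move=> Ax Ay Cx Cy; have xC := mem_set Cx; have yC := memNset Cy.
  rewrite /gdist [H x y]/H xC yC mulr0 subr0.
  (* Upper bound: a factor 2 from heights and 4 from [sep]. Lower bound: the triangle inequality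
     along x, p, r, y. *)
  apply/andP; split; last first.
    by have := hgt x Ax; have := hgt y Ay; have := sep x y Ax Ay Cx Cy; lra.
  rewrite /H xC yC.
  have /andP[+ _] := tree_approx_dist tG (conj Ar Cr) (conj Ay Cy).
  have /andP[+ _] := tree_approx_dist tG' (conj Ap Cp) (conj Ax Cx).
  rewrite (tree_approx_rootE tG)// (tree_approx_rootE tG')//.
  have := metric_triangle x p y; have := metric_triangle p r y.
  by rewrite (metric_sym x p) (metric_sym p r); lra.
have Hsym x y : A x -> A y -> H x y = H y x.
  move=> Ax Ay; have [[Cx xC]|[Cx xC]] := dec x; have [[Cy yC]|[Cy yC]] := dec y;
    rewrite /H xC yC//.
    by rewrite (gromov_on_sym (tree_approx_gromov tG') (conj Ax Cx) (conj Ay Cy)).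
  by rewrite (gromov_on_sym (tree_approx_gromov tG) (conj Ax Cx) (conj Ay Cy)).
have Hge0 x y : A x -> A y -> 0 <= H x y.
  move=> Ax Ay; have [[Cx xC]|[Cx xC]] := dec x; have [[Cy yC]|[Cy yC]] := dec y;
    rewrite /H xC yC//.
    by have := tree_approx_ge0 tG' (conj Ax Cx) (conj Ay Cy); lra.
  exact: (tree_approx_ge0 tG (conj Ax Cx) (conj Ay Cy)).
exists H; split => //.
- split=> // x y z Ax Ay Az; rewrite ge_min.
  have [[Cx xC]|[Cx xC]] := dec x; have [[Cy yC]|[Cy yC]] := dec y;
  have [[Cz zC]|[Cz zC]] := dec z; rewrite /H xC yC zC ?lexx ?orbT//.
  + have := gromov_on_min (tree_approx_gromov tG')
      (conj Ax Cx) (conj Ay Cy) (conj Az Cz).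
    by rewrite ge_min !lerD2l.
  + by rewrite addr_ge0 ?(tree_approx_ge0 tG') ?mdist_ge0.
  + by rewrite (tree_approx_ge0 tG).
  + have := gromov_on_min (tree_approx_gromov tG)
      (conj Ax Cx) (conj Ay Cy) (conj Az Cz).
    by rewrite ge_min.
- by rewrite /H rC (tree_approx_root tG).
- move=> x y Ax Ay.
  have [[Cx xC]|[Cx xC]] := dec x; have [[Cy yC]|[Cy yC]] := dec y.
  + have [m [[Am Cm] m1 m2 m3]] :=
      tree_approx_median tG' (conj Ax Cx) (conj Ay Cy).
    by exists m; rewrite /H (mem_set Cm) xC yC !lerD2l.
  + by exists r; rewrite /H rC xC yC (tree_approx_root tG) (tree_approx_ge0 tG).
  + by exists r; rewrite /H rC xC yC (tree_approx_root tG) (tree_approx_ge0 tG).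
  + have [m [[Am Cm] m1 m2 m3]] :=
      tree_approx_median tG (conj Ax Cx) (conj Ay Cy).
    by exists m; rewrite /H (memNset Cm) xC yC.
- move=> x y Ax Ay.
  have [[Cx xC]|[Cx xC]] := dec x; have [[Cy yC]|[Cy yC]] := dec y.
  + have := tree_approx_dist tG' (conj Ax Cx) (conj Ay Cy).
    by rewrite /gdist /H xC yC => /andP[? ?]; apply/andP; lra.
  + exact: dist10.
  + rewrite metric_sym (_ : gdist H x y = gdist H y x); first exact: dist10.
    by rewrite /gdist (Hsym x y)//; lra.
  + by have := tree_approx_dist tG (conj Ax Cx) (conj Ay Cy); rewrite /gdist /H xC yC.
Qed.

(** Induction on a bound for the length, for all roots at once, since the cluster is rooted at [p].
    Both sublists are shorter: the cluster omits [r], its complement omits [p]. *)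
Lemma finite_tree_approx (s : seq X) (r : X) : r \in s ->
  exists G, tree_approx r [set` s] G.
Proof.
elim: {s}(size s) {-2}s (leqnn (size s)) r => [|n IH] s.
  by rewrite leqn0 size_eq0 => /eqP ->.
move=> sn r rs.
have [|] := boolP (has (predC (pred1 r)) s); last first.
  rewrite -all_predC => /allP s_r.
  have sE x : [set` s] x -> x = r.
    by move=> /s_r /=; rewrite negbK => /eqP.
  exists (fun _ _ => 0); split => //.
  - by move=> x y xs ys; exists r.
  - by move=> x y /sE -> /sE ->; rewrite /gdist mdistxx; lra.
  - by move=> x _; rewrite mulr_ge0 ?mdist_ge0.
move=> /hasP[x0 x0s /= x0r].
have x0f : x0 \in [seq x <- s | x != r] by rewrite mem_filter x0r.
have [p + pmin] := seq_minimizer (mdist r) x0f.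
rewrite mem_filter => /andP[pr ps].
pose c x := 3 * mdist r p <= 2 * (mdist r x + mdist r p - mdist p x).
have b_gt0 : 0 < mdist r p by rewrite mdist_gt0 eq_sym.
have cp : c p by rewrite /c mdistxx; lra.
have cr : ~~ c r by rewrite /c mdistxx (metric_sym p r); apply/negP; lra.
have size_lt (a : pred X) x : x \in s -> ~~ a x -> (size [seq y <- s | a y] <= n)%N.
  move=> xs ax; rewrite -ltnS; apply: leq_trans sn.
  rewrite size_filter ltn_neqAle count_size andbT -all_count.
  by apply/negP => /allP /(_ _ xs); rewrite (negPf ax).
have [||G tG] := IH [seq x <- s | ~~ c x] _ r; first 2 last.
have [||G' tG'] := IH [seq x <- s | c x] _ p; first 2 last.
- apply: (@glue_tree_approx [set` s] r p G G') => //; first by rewrite eq_sym.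
  + by move=> x xs xr; apply: pmin; rewrite mem_filter xr.
  + rewrite (_ : _ `\` _ = [set` [seq x <- s | ~~ c x]])//.
    by apply/seteqP; split => x /=; rewrite mem_filter;
      [move=> [xs /negP ->]|move=> /andP[/negP]].
  + rewrite (_ : _ `&` _ = [set` [seq x <- s | c x]])//.
    by apply/seteqP; split => x /=; rewrite mem_filter;
      [move=> [xs xc]; rewrite /c xc xs|move=> /andP[]].
- exact: (size_lt _ r).
- by rewrite mem_filter cp.
- by apply: (size_lt _ p); rewrite // negbK.
- by rewrite mem_filter cr.
Qed.

End finite_tree_approx.

(** * The limit along an ultrafilter on finite subsets *)

(** The image of an ultrafilter is an ultrafilter, because [U] contains the preimage of any set or
    of its complement. *)
Lemma compact_ultra_cvg (T : topologicalType) (I : Type) (U : set_system I)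
    (f : I -> T) (K : set T) : UltraFilter U -> compact K ->
  (\forall i \near U, K (f i)) -> exists2 l, K l & f i @[i --> U] --> l.
Proof.
move=> UU; rewrite compact_ultra => cK UK.
suff UfU : UltraFilter (f @ U) by have [l [Kl fl]] := cK _ UfU UK; exists l.
split=> [|G GG fUG]; first exact: fmap_proper_filter.
rewrite eqEsubset; split=> [A GA|]; last exact: fUG.
have [//|UAC] := in_ultra_setVsetC (f @^-1` A) UU.
have /filter_ex[? []] : G (A `&` ~` A) by apply: filterI => //; exact: fUG.
by [].
Qed.

(* The library's [ler_cvg_to] requires the index type to be topological. *)
Lemma ler_filter_cvg (R : realFieldType) (I : Type) (F : set_system I)
    (FF : ProperFilter F) (f g : I -> R) (l l' : R) :
  f @ F --> l -> g @ F --> l' -> (\forall i \near F, f i <= g i) -> l <= l'.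
Proof.
move=> fl gl fg; rewrite -subr_ge0; apply: (cvgr_to_ge (cvgB gl fl)).
by apply: filterS fg => i; rewrite subr_ge0.
Qed.

Lemma finite_subsets_ultrafilter (T : eqType) :
  exists U : set_system (seq T), UltraFilter U /\
    forall x, \forall s \near U, x \in s.
Proof.
pose F := filter_from [set: seq T] (fun s => [set s' : seq T | {subset s <= s'}]).
have FF : ProperFilter F.
  apply: filter_from_proper; last by move=> s _; exists s.
  apply: filter_from_filter; first by exists [::].
  move=> s s' _ _; exists (s ++ s') => // s'' /= sub; split=> x xs;
    by apply: sub; rewrite mem_cat xs ?orbT.
have [U [UU FU]] := ultraFilterLemma FF.
exists U; split=> // x; apply: FU; exists [:: x] => // s sub.
by apply: sub; rewrite mem_head.
Qed.

Lemma proper_tree_approx (R : realType) (X : metricType R) (r : X) :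
  hyperbolic0 X -> proper_space X -> exists G, tree_approx r [set: X] G.
Proof.
move=> hypX propX.
have [U [UU UX]] := finite_subsets_ultrafilter X.
have /choice[G GP] (s : seq X) : exists G, tree_approx r [set` r :: s] G.
  exact: (finite_tree_approx hypX (mem_head r s)).
have inU x : \forall s \near U, [set` r :: s] x.
  by near=> s; rewrite /= inE; apply/orP; right; near: s; exact: UX.
have Ur s : [set` r :: s] r by exact: mem_head.
have /choice[L LP] (xy : X * X) :
    exists l : R, G s xy.1 xy.2 @[s --> U] --> l.
  case: xy => x y /=.
  (* Products are at most the height of [x], hence confined to a compact interval independent of
     [s]. *)
  have [|l _ Gl] := @compact_ultra_cvg R _ U (fun s => G s x y) _ UU
    (@segment_compact R 0 (2 * mdist r x)); last by exists l.
  near=> s.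
  have xs : [set` r :: s] x by near: s; exact: inU.
  have ys : [set` r :: s] y by near: s; exact: inU.
  rewrite /= in_itv/= (tree_approx_ge0 (GP s))//=.
  apply: le_trans (tree_approx_height (GP s) xs).
  exact: (gromov_le_diag (tree_approx_gromov (GP s)) xs ys).
have lim x y : G s x y @[s --> U] --> L (x, y) by exact: (LP (x, y)).
have cst (c : R) : (fun _ : seq X => c) @ U --> c by apply: cvg_cst.
have limd x y : gdist (G s) x y @[s --> U] --> gdist (fun x y => L (x, y)) x y.
  exact: cvgB (cvgD (lim _ _) (lim _ _)) (cvgM (cst 2) (lim _ _)).
exists (fun x y => L (x, y)); split.
- split=> [x y _ _|x y z _ _ _].
    apply/eqP; rewrite eq_le; apply/andP; split;
      apply: (ler_filter_cvg _ (lim _ _) (lim _ _)); near=> s;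
      by rewrite (gromov_on_sym (tree_approx_gromov (GP s)))//; near: s; exact: inU.
  (* If the inequality failed in the limit, the midpoint [(a + q) / 2] would separate the products
     for some [s], where the inequality holds. *)
  rewrite leNgt lt_min; apply/negP => /andP[].
  set a := L (x, y) => axz azy.
  pose q := Num.min (L (x, z)) (L (z, y)).
  have aq : a < (a + q) / 2 by rewrite midf_lt// lt_min axz azy.
  have [qxz qzy] : (a + q) / 2 < L (x, z) /\ (a + q) / 2 < L (z, y).
    by apply/andP; rewrite -lt_min midf_lt// lt_min axz azy.
  have [s []] : exists s, Num.min (G s x z) (G s z y) <= G s x y /\
      [/\ (a + q) / 2 < G s x z, (a + q) / 2 < G s z y & G s x y < (a + q) / 2].
    apply: (@filter_ex _ U); near=> s; split.
      apply: (gromov_on_min (tree_approx_gromov (GP s)));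
        by near: s; exact: inU.
    split; near: s; [exact: cvgr_gt qxz|exact: cvgr_gt qzy|exact: cvgr_lt aq].
  by rewrite ge_min => /orP[] ? []; lra.
- apply/eqP; rewrite eq_le; apply/andP; split;
    [apply: (ler_filter_cvg _ (lim _ _) (cst 0))|apply: (ler_filter_cvg _ (cst 0) (lim _ _))];
    by near=> s; rewrite (tree_approx_root (GP s)).
- move=> x y _ _; apply: (ler_filter_cvg _ (cst 0) (lim _ _)); near=> s.
  by apply: (tree_approx_ge0 (GP s)); near: s; exact: inU.
- move=> x y _ _.
  (* Medians [m s] of the approximations; their distance to [r] is at most the height of [x], so by
     properness they converge. The value [x] is a default for lists missing [x] or [y]. *)
  have /choice[m mP] (s : seq X) : exists m, [set` r :: s] x ->
      [set` r :: s] y -> [/\ [set` r :: s] m, G s m m <= G s x y,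
        G s x y <= G s m x & G s x y <= G s m y].
    have [xs|] := pselect ([set` r :: s] x); last by exists x.
    have [ys|] := pselect ([set` r :: s] y); last by exists x.
    by have [m] := tree_approx_median (GP s) xs ys; exists m.
  have [|l _ ml] := compact_ultra_cvg (f := m) UU (propX r (2 * mdist r x)).
    near=> s.
    have xs : [set` r :: s] x by near: s; exact: inU.
    have ys : [set` r :: s] y by near: s; exact: inU.
    have [ms mm _ _] := mP s xs ys => /=.
    have /andP[rm _] := tree_approx_dist (GP s) (Ur s) ms.
    apply: (le_trans rm); rewrite (tree_approx_rootE (GP s))//.
    apply: (le_trans mm); apply: le_trans (tree_approx_height (GP s) xs).
    exact: (gromov_le_diag (tree_approx_gromov (GP s)) xs ys).
  have close e : 0 < e -> \forall s \near U, [/\ G s l l <= G s x y + e,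
      G s x y <= G s l x + e & G s x y <= G s l y + e].
    move=> e0; near=> s.
    have xs : [set` r :: s] x by near: s; exact: inU.
    have ys : [set` r :: s] y by near: s; exact: inU.
    have ls : [set` r :: s] l by near: s; exact: inU.
    have [ms mm mx my] := mP s xs ys.
    (* The tree distance is at most 8 times [mdist], so heights and products change by at most [e]
       between [m s] and [l]. *)
    have lm : ball l (e / 8) (m s).
      by near: s; apply: ml; apply: nbhsx_ballx; rewrite divr_gt0.
    rewrite ballEmdist/= in lm.
    have /andP[_ d8] := tree_approx_dist (GP s) ls ms.
    have gs := tree_approx_gromov (GP s).
    have := gromov_height_lip gs ls ms; rewrite ler_norml => /andP[_ ?].
    have := gromov_lip gs ls ms xs; have := gromov_lip gs ls ms ys.
    by split; lra.
  exists l; split=> //; apply/ler_addgt0Pr => e e0.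
  + apply: (ler_filter_cvg _ (lim l l) (cvgD (lim x y) (cst e))).
    by near=> s; have [] := near (close e e0) s.
  + apply: (ler_filter_cvg _ (lim x y) (cvgD (lim l x) (cst e))).
    by near=> s; have [] := near (close e e0) s.
  + apply: (ler_filter_cvg _ (lim x y) (cvgD (lim l y) (cst e))).
    by near=> s; have [] := near (close e e0) s.
- move=> x y _ _.
  have dxy : \forall s \near U, mdist x y <= gdist (G s) x y <= 8 * mdist x y.
    near=> s; have xs : [set` r :: s] x by near: s; exact: inU.
    have ys : [set` r :: s] y by near: s; exact: inU.
    exact: tree_approx_dist (GP s) _ _ xs ys.
  apply/andP; split;
    [apply: (ler_filter_cvg _ (cst _) (limd _ _))|
     apply: (ler_filter_cvg _ (limd _ _) (cst _))];
    by apply: filterS dxy => s /andP[].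
- move=> x _; apply: (ler_filter_cvg _ (lim _ _) (cst _)); near=> s.
  by apply: (tree_approx_height (GP s)); near: s; exact: inU.
Unshelve. all: by end_near. Qed.

(** * The metric quotient of a Gromov product *)

Section gromov_quotient.
Context {R : realType} {T : choiceType} (P : T -> T -> R).
Hypothesis gP : gromov_on setT P.

(** Points at distance 0 define the same predicate, so [choose] gives them the same representative;
    the quotient is the subtype of representatives. *)
Definition gromov_repr (p : T) : T := choose (fun q => gdist P p q == 0) p.

Lemma gdistxx p : gdist P p p = 0.
Proof. by rewrite /gdist; lra. Qed.

Lemma gdist_gromov_repr p : gdist P p (gromov_repr p) = 0.
Proof.
by apply/eqP/(@chooseP _ (fun q => gdist P p q == 0)); rewrite gdistxx.
Qed.

Lemma gdist0_l p q z : gdist P p q = 0 -> gdist P p z = gdist P q z.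
Proof.
move=> pq; apply/eqP; rewrite eq_le.
have := gdist_triangle gP (z := q) (p := p) (q := z) I I I.
have := gdist_triangle gP (z := p) (p := q) (q := z) I I I.
by rewrite (gdistC gP (p := q) (q := p)) // pq => ? ?; apply/andP; lra.
Qed.

Lemma gromov_repr_eq p q : gdist P p q = 0 -> gromov_repr p = gromov_repr q.
Proof.
move=> pq; rewrite /gromov_repr.
rewrite (eq_choose (Q := fun z => gdist P q z == 0)); last first.
  by move=> z; rewrite (gdist0_l z pq).
by apply: choose_id; rewrite ?gdistxx // (gdistC gP) // pq.
Qed.

(** The proof is an argument of the type so that the metric instance can find its axioms there. *)
Definition gromov_quotient of gromov_on setT P :=
  {p : T | gromov_repr p == p}.

End gromov_quotient.

Section gromov_quotient_metric.
Context {R : realType} {T : choiceType} (P : T -> T -> R).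
Variable gP : gromov_on setT P.
Local Notation Q := (gromov_quotient gP).

HB.instance Definition _ := Choice.on Q.

Lemma gromov_repr_idem p : gromov_repr P (gromov_repr P p) == gromov_repr P p.
Proof.
by apply/eqP/esym/gromov_repr_eq => //; exact: gdist_gromov_repr.
Qed.

Definition gromov_class (p : T) : Q := exist _ (gromov_repr P p) (gromov_repr_idem p).

Let qdist (u v : Q) : R := gdist P (val u) (val v).

Let qdistxx u : qdist u u = 0.
Proof. exact: gdistxx. Qed.

Let qdist_positivity u v : qdist u v = 0 -> u = v.
Proof.
move=> /(gromov_repr_eq gP) uv; apply: val_inj.
by rewrite -(eqP (valP u)) -(eqP (valP v)).
Qed.

Let qdist_sym u v : qdist u v = qdist v u.
Proof. exact: (gdistC gP). Qed.

Let qdist_triangle v u w : qdist u w <= qdist u v + qdist v w.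
Proof. exact: (gdist_triangle gP). Qed.

HB.instance Definition _ := @isMetric.Build R Q qdist
  qdistxx qdist_positivity qdist_sym qdist_triangle.

Lemma mdist_gromov_class p q :
  mdist (gromov_class p) (gromov_class q) = gdist P p q.
Proof.
rewrite /mdist/= /qdist /= -(gdist0_l gP _ (gdist_gromov_repr P p)).
rewrite (gdistC gP)// -(gdist0_l gP _ (gdist_gromov_repr P q)).
exact: (gdistC gP).
Qed.

Lemma gromov_classP (u : Q) : exists p, u = gromov_class p.
Proof.
by exists (val u); apply: val_inj => /=; rewrite (eqP (valP u)).
Qed.

Lemma gromov_class_eq p q :
  gdist P p q = 0 -> gromov_class p = gromov_class q.
Proof. by move=> pq; apply: mdist_positivity; rewrite mdist_gromov_class. Qed.

Lemma gromov_quotient_hyperbolic0 : hyperbolic0 Q.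
Proof.
move=> x y z w.
have [[{x}x ->] [{y}y ->]] := (gromov_classP x, gromov_classP y).
have [[{z}z ->] [{w}w ->]] := (gromov_classP z, gromov_classP w).
by rewrite !mdist_gromov_class; exact: (gdist_4point gP).
Qed.

End gromov_quotient_metric.

(* Innermost minima first, so that no [min] survives in the hypotheses. *)
Ltac case_min := repeat match goal with
  |- context [Order.min ?a ?b] =>
    lazymatch constr:((a, b)) with
    | context [Order.min _ _] => fail
    | _ => case: (leP a b) => ?
    end
end.

(** * The tree of rays: geodesics, completeness and singular points *)

Section ray_tree.
Context {R : realType} {X : metricType R} {r : X} (G : X -> X -> R).
Hypothesis tG : tree_approx r [set: X] G.

(* The pair [(x, s)] stands for the point at height [s] on the ray that comes
   from below the root through the root and ends at [x]; heights above that of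
   [x] are identified with [x]. Heights are not required to be nonnegative, so
   the tree contains an extra infinite ray attached at the root. *)
Definition ray_gromov (p q : X * R) : R :=
  Num.min (Num.min p.2 q.2) (G p.1 q.1).

Lemma ray_gromov_on : gromov_on [set: X * R] ray_gromov.
Proof.
have gG := tree_approx_gromov tG.
split=> [[x s] [y t] _ _|[x s] [y t] [z u] _ _ _]; rewrite /ray_gromov/=.
  by rewrite (minC s) (gromov_on_sym gG).
have := gromov_on_min gG (p := x) (q := y) (z := z) I I I.
rewrite !le_min !ge_min !lexx /= ?orbT /=.
by case/orP=> ->; rewrite ?orbT.
Qed.

Local Notation Y := (gromov_quotient ray_gromov_on).
Local Notation pt x s := (gromov_class ray_gromov_on (x, s)).

Definition ray_inj (x : X) : Y := pt x (G x x).

Definition ray_height (u : Y) : R^o := ray_gromov (val u) (val u).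

Lemma ray_heightE (x : X) (s : R) : ray_height (pt x s) = Num.min s (G x x).
Proof.
have := gromov_height_lip ray_gromov_on (p := gromov_repr ray_gromov (x, s))
  (q := (x, s)) I I.
rewrite (gdistC ray_gromov_on)// gdist_gromov_repr normr_le0 subr_eq0.
by move=> /eqP hE; apply: (etrans hE); rewrite /ray_gromov minxx.
Qed.

Lemma mdist_ray_inj (x y : X) : mdist (ray_inj x) (ray_inj y) = gdist G x y.
Proof.
have gG := tree_approx_gromov tG.
rewrite mdist_gromov_class /gdist /ray_gromov/= !minxx.
have := gromov_le_diag gG (p := x) (q := y) I I.
have := gromov_le_diag gG (p := y) (q := x) I I.
by rewrite (gromov_on_sym gG (p := y) (q := x))//; case_min; lra.
Qed.

Lemma mdist_same_ray (x : X) (s t : R) :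
  mdist (pt x s) (pt x t) = `|Num.min s (G x x) - Num.min t (G x x)|.
Proof.
rewrite mdist_gromov_class /gdist /ray_gromov/= !minxx.
by case_min; case: ger0P; lra.
Qed.

(* If [u] left the ray of [x], the branching point would be a median of the
   approximation, hence in the image of [X] and closer to the center than [u]. *)
Lemma ball_on_ray (x : X) (s e : R) :
  (forall z, ~ ball (pt x s) e (ray_inj z)) ->
  forall u : Y, ball (pt x s) e u -> u = pt x (ray_height u).
Proof.
have gG := tree_approx_gromov tG.
move=> miss u; have [[x' s'] ->] := gromov_classP u.
rewrite ballEmdist/= mdist_gromov_class ray_heightE => ue.
apply: gromov_class_eq.
have [m [_ m1 m2 m3]] := tree_approx_median tG (x := x) (y := x') I I.
have := miss m; rewrite ballEmdist/= mdist_gromov_class => /negP.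
rewrite -leNgt; move: ue; rewrite /gdist /ray_gromov/= !minxx.
set c := Num.min (Num.min s s') _; set c' := Num.min (Num.min s _) _.
set h := Num.min s' _ => yu ym.
have hs : h <= s' by rewrite /h ge_min lexx.
have mk : G x x' <= G m m by apply: le_trans m2 _; exact: (gromov_le_diag gG I I).
have [hk|kh] := leP h (G x x'); last first.
  suff : c <= c' by lra.
  rewrite /c' !le_min (gromov_on_sym gG (p := x) (q := m))// -andbA.
  by apply/and3P; split; rewrite /c ge_min ?mk ?m2 ?orbT// ge_min lexx.
have kx := gromov_le_diag gG (p := x) (q := x') I I.
rewrite (gromov_on_sym gG (p := x') (q := x))// (min_r hs) (min_l hk).
by rewrite (min_l (le_trans hk kx)); lra.
Qed.

Lemma ray_height_isometric (x : X) (s e : R) :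
  (forall z, ~ ball (pt x s) e (ray_inj z)) ->
  isometric_on (ball (pt x s) e) ray_height.
Proof.
move=> miss u v /(ball_on_ray miss) uE /(ball_on_ray miss) vE.
rewrite [in RHS]uE [in RHS]vE mdist_same_ray -!ray_heightE -uE -vE.
exact: distrC.
Qed.

Lemma ray_tree_geodesic : geodesic Y.
Proof.
move=> u v; have [[x s] uE] := gromov_classP u; have [[y t] vE] := gromov_classP v.
have := gromov_le_diag ray_gromov_on (p := (x, s)) (q := (y, t)) I I.
have := gromov_le_diag ray_gromov_on (p := (y, t)) (q := (x, s)) I I.
rewrite (gromov_on_sym ray_gromov_on (p := (y, t)) (q := (x, s)))//.
pose m := ray_gromov (x, s) (y, t); rewrite -/m.
pose s' := ray_gromov (x, s) (x, s); pose t' := ray_gromov (y, t) (y, t).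
rewrite -/s' -/t' => mt ms.
have ux : u = pt x s'.
  apply: mdist_positivity; rewrite uE mdist_same_ray /s' /ray_gromov/= minxx.
  by rewrite -minA minxx subrr normr0.
have vy : v = pt y t'.
  apply: mdist_positivity; rewrite vE mdist_same_ray /t' /ray_gromov/= minxx.
  by rewrite -minA minxx subrr normr0.
have sx : s' <= G x x by rewrite /s' /ray_gromov/= ge_min lexx orbT.
have ty : t' <= G y y by rewrite /t' /ray_gromov/= ge_min lexx orbT.
have mxy : m <= G x y by rewrite /m /ray_gromov/= ge_min lexx orbT.
have mge : Num.min (Num.min s' t') (G x y) <= m.
  by rewrite /m /s' /t' /ray_gromov/= !minxx !le_min !ge_min !lexx /= ?orbT.
clearbody m s' t'.
have mE : m = Num.min (Num.min s' t') (G x y).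
  by apply/le_anti/andP; split=> //; rewrite !le_min ms mt mxy.
(* Descend the ray of [x] from height [s'] to the branching height [m], then ascend the ray of [y]
   to [t']. *)
pose g (a : R) : Y := if a <= s' - m then pt x (s' - a) else pt y (2 * m + a - s').
have cross a b : m <= a <= s' -> m <= b <= t' -> mdist (pt x a) (pt y b) = a + b - 2 * m.
  move=> /andP[ma as'] /andP[mb bt']; rewrite mdist_gromov_class /gdist.
  rewrite /ray_gromov/= !minxx (min_l (le_trans as' sx)) (min_l (le_trans bt' ty)).
  congr (_ - 2 * _); apply/le_anti/andP; split; last by rewrite !le_min ma mb mxy.
  by rewrite [leRHS]mE !le_min !ge_min as' bt' lexx !orbT.
have same (z : X) h a b : h <= G z z -> a <= h -> b <= h -> mdist (pt z a) (pt z b) = `|a - b|.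
  by move=> hz ah bh; rewrite mdist_same_ray !min_l//; apply: le_trans hz.
have g_isom (a b : R) : 0 <= a <= s' + t' - 2 * m ->
    0 <= b <= s' + t' - 2 * m -> mdist (g a) (g b) = `|b - a|.
  move=> /andP[a0 a1] /andP[b0 b1]; rewrite /g.
  have [asm|asm] := leP a (s' - m); have [bsm|bsm] := leP b (s' - m).
  + by rewrite (same _ s')//; [congr `|_|; lra|lra|lra].
  + by rewrite cross; [case: ger0P; lra|apply/andP; lra|apply/andP; lra].
  + by rewrite metric_sym cross; [case: ger0P; lra|apply/andP; lra|apply/andP; lra].
  + by rewrite (same _ t')//; [rewrite distrC; congr `|_|; lra|lra|lra].
exists 0, (s' + t' - 2 * m), g; split; first lra.
- by move=> a b /=; rewrite !in_itv/=; exact: g_isom.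
- by rewrite /g ifT ?subr0; [rewrite ux|lra].
(* If [t' = m] there is no ascent, and the endpoint is computed on the ray of [x]. *)
- rewrite /g; case: ifPn => [tm|_]; last by rewrite vy; congr (pt y _); lra.
  have -> : s' - (s' + t' - 2 * m) = m by lra.
  by apply: mdist_positivity; rewrite vy cross ?lexx ?ms ?mt//; lra.
Qed.

Section proper.
Hypothesis propX : proper_space X.

(** The centers of small balls in [F] generate a filter [H]; it contains a bounded set, so
    properness gives a cluster point, to which [F] converges. It serves Cauchy filters as well as
    neighborhood filters. *)
Lemma cvg_ray_inj (F : set_system Y) : ProperFilter F ->
  (forall e, 0 < e -> exists z, F (ball (ray_inj z) e)) ->
  exists z, F --> ray_inj z.
Proof.
move=> FF near_inj.
have dX x y := tree_approx_dist tG (x := x) (y := y) I I.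
pose H := filter_from [set e : R | 0 < e] (fun e => [set z | F (ball (ray_inj z) e)]).
have HF : ProperFilter H.
  apply: filter_from_proper; last exact: near_inj.
  apply: filter_from_filter; first by exists 1 => /=.
  move=> e e' /= e0 e'0; exists (Num.min e e'); first by rewrite lt_min e0 e'0.
  move=> z /= Fz; split; apply: filterS Fz; apply: le_ball;
    by rewrite ge_min lexx ?orbT.
have [z1 Fz1] := near_inj 1 ltr01.
have HK : H [set z | mdist z1 z <= 2].
  exists 1 => //= z Fz.
  have /filter_ex[u []] : F (ball (ray_inj z1) 1 `&` ball (ray_inj z) 1).
    exact: filterI.
  rewrite !ballEmdist/= => z1u zu.
  have := metric_triangle (ray_inj z1) u (ray_inj z).
  rewrite (metric_sym u) mdist_ray_inj; have /andP[+ _] := dX z1 z; lra.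
have [z0 [_ z0H]] := propX HF HK.
exists z0 => A /nbhs_ballP[e /= e0 eA].
have e2 : 0 < e / 2 by rewrite divr_gt0.
(* Points at distance [e / 16] in X are at most [e / 2] apart in the tree. *)
have e16 : 0 < e / 16 by rewrite divr_gt0.
have He : H [set z | F (ball (ray_inj z) (e / 2))] by exists (e / 2).
have [z [Fz]] := z0H _ _ He (nbhsx_ballx z0 _ e16).
rewrite ballEmdist/= => z0z; apply: filterS Fz => u zu; apply: eA.
move: zu; rewrite !ballEmdist/=; have := metric_triangle (ray_inj z0) (ray_inj z) u.
by rewrite mdist_ray_inj; have /andP[_ +] := dX z0 z; lra.
Qed.

Lemma ball_miss_ray_inj (F : set_system Y) (u : Y) (e : R) : Filter F ->
  (forall z, ~ F (ball (ray_inj z) e)) -> F (ball u (e / 2)) ->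
  forall z, ~ ball u (e / 2) (ray_inj z).
Proof.
move=> FF Fz Fu z uz; apply: (Fz z); apply: filterS Fu => v uv.
exact: ball_splitr uz uv.
Qed.

(** Either [cvg_ray_inj] applies, or [F] contains a ball missing X, which lies on one ray; there the
    heights, being 1-Lipschitz, converge and determine the limit. *)
Lemma ray_tree_complete : complete_space Y.
Proof.
move=> F FF cF.
have [/(cvg_ray_inj FF)[z Fz]|] :=
  pselect (forall e, 0 < e -> exists z, F (ball (ray_inj z) e)).
  by exists (ray_inj z).
move=> /existsNP[e /not_implyP[e0 /forallNP Fz]].
have /cauchyP cF' := cF.
have [u Fu] := cF' (e / 2) (divr_gt0 e0 (ltr0n _ 2)).
have miss := ball_miss_ray_inj FF Fz Fu.
have [[x s] uE] := gromov_classP u; rewrite uE in miss Fu.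
have /cvg_ex[/= t Ft] : cvg (ray_height @ F).
  apply/cauchy_cvgP/cauchyP => d d0; have [v Fv] := cF' d d0.
  exists (ray_height v).
  suff : F (ray_height @^-1` ball (ray_height v) d) by [].
  apply: filterS Fv => w vw.
  have {}vw : mdist v w < d by move: vw; rewrite ballEmdist.
  apply: le_lt_trans vw.
  exact: (gromov_height_lip ray_gromov_on).
exists (pt x t) => A /nbhs_ballP[d /= d0 dA].
have Fd : F (ray_height @^-1` ball t d) by apply: Ft; exact: nbhsx_ballx.
apply: filterS2 Fu Fd => v /(ball_on_ray miss) vE.
rewrite /ball/= => td; apply: dA; rewrite ballEmdist/= vE mdist_same_ray.
apply: le_lt_trans td.
have lip (a b c : R) : `|Num.min a c - Num.min b c| <= `|a - b|.
  have := ler_norm (a - b); have := ler_norm (b - a); rewrite (distrC b).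
  by rewrite ler_norml; case_min => ? ?; apply/andP; lra.
exact: lip.
Qed.

(** The same dichotomy for the neighborhood filter of [u]: either [u] is an image point, or the
    height is an isometric chart around it. *)
Lemma sing_ray_tree : sing Y `<=` range ray_inj.
Proof.
move=> u; rewrite /sing/=; apply: contra_notP => u_inj.
have [/(cvg_ray_inj (nbhs_pfilter u))[z uz]|] :=
  pselect (forall e, 0 < e -> exists z, nbhs u (ball (ray_inj z) e)).
  exfalso; apply: u_inj; exists z => //; apply: mdist_positivity.
  apply/le_anti; rewrite mdist_ge0 andbT; apply/ler_addgt0Pl => e e0.
  have /nbhs_singleton : nbhs u (ball (ray_inj z) e).
    by apply: uz; exact: nbhsx_ballx.
  by rewrite ballEmdist/= addr0 => /ltW.
move=> /existsNP[e /not_implyP[e0 /forallNP Fz]].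
have e2 : 0 < e / 2 by rewrite divr_gt0.
exists (e / 2) => //; exists ray_height.
have miss := ball_miss_ray_inj (nbhs_filter u) Fz (nbhsx_ballx u _ e2).
have [[x s] uE] := gromov_classP u; rewrite uE in miss *.
exact: ray_height_isometric miss.
Qed.

End proper.
End ray_tree.

Theorem theorem1p8 (R : realType) (X : metricType R) :
  hyperbolic0 X -> proper_space X ->
  exists (Y : metricType R) (f : X -> Y),
    [/\ complete_space Y, R_tree Y, bilipschitz 8 f & sing Y `<=` range f].
Proof.
move=> hypX propX.
(* The construction needs a root; an empty X is itself a tree with all the properties. *)
have [[r _]|X0] := pselect (exists r : X, True); last first.
  have noX (x : X) : False by apply: X0; exists x.
  exists X, id; split.
  - by move=> F FF _; have /filter_ex[x] := @filterT _ F FF; case: (noX x).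
  - by split=> x; case: (noX x).
  - by exists 1 => // x; case: (noX x).
  - by move=> x; case: (noX x).
have [G tG] := proper_tree_approx r hypX propX.
exists (gromov_quotient (ray_gromov_on tG)), (ray_inj tG); split.
- exact: ray_tree_complete.
- by split; [exact: ray_tree_geodesic|exact: gromov_quotient_hyperbolic0].
- exists 1 => // x y; rewrite mulr1 mul1r mdist_ray_inj.
  exact: tree_approx_dist tG x y I I.
- exact: sing_ray_tree.
Qed.
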